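(* For every integer $n > 2$ there exists an element $A \in \mathcal{H}_n$ which has core exponential growth, i.e. there is a constant $c>0$ such that $|\min \mathrm{Core}(A^m)| \ge e^{cm}$ for all sufficiently large $m \in \mathbb{N}$.
   Context: Let $n \ge 2$ and $X_n=\{0,1,\ldots,n-1\}$. A synchronous transducer (automaton) is a tuple $A=\langle X_n,Q_A,\pi_A,\lambda_A\rangle$ with state set $Q_A$, transition function $\pi_A: X_n\times Q_A\to Q_A$ and output function $\lambda_A: X_n\times Q_A\to X_n$. These extend to words by $\pi_A(\epsilon,q)=q$, $\lambda_A(\epsilon,q)=\epsilon$ (with $\epsilon$ the empty word), $\pi_A(\Gamma x,q)=\pi_A(x,\pi_A(\Gamma,q))$ and $\lambda_A(\Gamma x,q)=\lambda_A(\Gamma,q)\lambda_A(x,\pi_A(\Gamma,q))$. Each state $q$ induces a continuous map $X_n^{\mathbb N}\to X_n^{\mathbb N}$. Two states are $\omega$-equivalent if they induce the same map; $A$ is minimal if no two distinct states are $\omega$-equivalent; $\min A$ denotes the minimal transducer obtained by identifying $\omega$-equivalent states. Two minimal transducers are $\omega$-equivalent if there is a bijection between their state sets such that corresponding states induce the same map; transducers are considered up to $\omega$-equivalence, and are represented by minimal transducers. $|A|$ denotes the number of states of $A$. $A$ is synchronizing at level $k\ge 0$ if there is a map $\mathfrak s:X_n^k\to Q_A$ with $\pi_A(\Gamma,q)=\mathfrak s(\Gamma)$ for all $\Gamma\in X_n^k$, $q\in Q_A$; it is strongly synchronizing if this holds for some $k$. The image of $\mathfrak s$ is the state set of a subtransducer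 $\mathrm{Core}(A)$; $A$ is core if $A=\mathrm{Core}(A)$. The product $A*B$ has state set $Q_A\times Q_B$, with $\pi_{A*B}(x,(p,q))=(\pi_A(x,p),\pi_B(\lambda_A(x,p),q))$ and $\lambda_{A*B}(x,(p,q))=\lambda_B(\lambda_A(x,p),q)$. $A^m$ is the $m$-fold product $A*\cdots*A$; products of strongly synchronizing transducers are strongly synchronizing. $\widetilde{\mathcal P}_n$ is the monoid of ($\omega$-equivalence classes of) core, strongly synchronizing, synchronous transducers over $X_n$, with multiplication $(A,B)\mapsto\min\mathrm{Core}(A*B)$. An element $A\in\widetilde{\mathcal P}_n$, synchronizing at level $k$, induces a shift-commuting map $f_A:X_n^{\mathbb Z}\to X_n^{\mathbb Z}$ by $(x_i)_{i\in\mathbb Z}\mapsto(y_i)_{i\in\mathbb Z}$, $y_i=\lambda_A(x_i,\mathfrak s(x_{i-k}\cdots x_{i-1}))$. $\mathcal P_n$ is the submonoid of those $A$ for which $f_A$ is a homeomorphism. A synchronous transducer $A$ has an automaton theoretic inverse if for every state $q$ the map $\lambda_A(\cdot,q):X_n\to X_n$ is a bijection; the inverse $A^{-1}$ has states $q^{-1}$ ($q\in Q_A$) with $\pi_{A^{-1}}(x,q^{-1})=p^{-1}$ and $\lambda_{A^{-1}}(x,q^{-1})=y$ if and only if $\pi_A(y,q)=p$ and $\lambda_A(y,q)=x$. $\mathcal H_n$ is the set of elements of $\mathcal P_n$ which have an automaton theoretic inverse (this inverse is then again in $\mathcal P_n$). $A\in\mathcal P_n$ has core exponential growth if $m\mapsto|\min\mathrm{Core}(A^m)|$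 grows exponentially in $m$. *)

(* Defs.v *)
From HB Require Import structures.
From mathcomp Require Import all_boot all_order all_algebra.
From mathcomp Require Import boolp classical_sets reals topology sequences.

Set Implicit Arguments.
Unset Strict Implicit.
Unset Printing Implicit Defensive.

Import Order.TTheory GRing.Theory Num.Theory.

Local Open Scope quotient_scope.

(* State sets are finite: the states of a core strongly synchronizing
   transducer are the image of a map from X_n^k, and products, cores and
   quotients of finite transducers are finite. *)
Record transducer (n : nat) := Transducer {
  state :> finType;
  trans : 'I_n -> state -> state;
  out : 'I_n -> state -> 'I_n
}.

Section Transducer.
Variable n : nat.
Implicit Types A B : transducer n.

Definition wtrans A (w : seq 'I_n) (q : A) : A :=
  foldl (fun p x => trans x p) q w.

Fixpoint wout A (w : seq 'I_n) (q : A) : seq 'I_n :=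
  if w is x :: w' then out x q :: wout w' (trans x q) else [::].

Lemma wtrans_rcons A w x (q : A) :
  wtrans (rcons w x) q = trans x (wtrans w q).
Proof. by rewrite /wtrans -cats1 foldl_cat. Qed.

Lemma wout_rcons A w x (q : A) :
  wout (rcons w x) q = rcons (wout w q) (out x (wtrans w q)).
Proof. by elim: w q => //= y w IHw q; rewrite IHw. Qed.

Definition state_map A (q : A) (x : nat -> 'I_n) : nat -> 'I_n :=
  fun i => out (x i) (wtrans (mkseq x i) q).

Lemma mkseq_state_map A (q : A) x m :
  mkseq (state_map q x) m = wout (mkseq x m) q.
Proof.
elim: m => // m IHm.
by rewrite !mkseqS wout_rcons IHm.
Qed.

Definition omega_equiv A (p q : A) : bool :=
  `[< state_map p = state_map q >].

Definition minimal A := forall p q : A, omega_equiv p q -> p = q.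

Lemma omega_equiv_is_equiv A : equiv_class_of (@omega_equiv A).
Proof.
split=> [p|p q|q p r].
- exact/asboolP.
- by apply/asboolP/asboolP => ->.
- by move=> /asboolP pq /asboolP qr; apply/asboolP; rewrite pq.
Qed.

Canonical omega_equiv_rel A := EquivRelPack (omega_equiv_is_equiv A).

Definition min_state A := {eq_quot @omega_equiv_rel A}.
HB.instance Definition _ A := Quotient.on (min_state A).
HB.instance Definition _ A := [Finite of min_state A by <:%/].

Definition minT A : transducer n := @Transducer n (min_state A)
  (fun x c => \pi_(min_state A) (trans x (repr c))) (fun x c => out x (repr c)).

Lemma omega_equiv_out A (p q : A) x : omega_equiv p q -> out x p = out x q.
Proof. by move=> /asboolP/(congr1 (fun f => f (fun=> x) 0)). Qed.

Lemma state_map_trans A (q : A) x (u : nat -> 'I_n) i :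
  state_map (trans x q) u i =
  state_map q (fun j => if j is j'.+1 then u j' else x) i.+1.
Proof.
by rewrite /state_map /mkseq /= (iotaDl 1 0 i) -map_comp.
Qed.

Lemma omega_equiv_trans A (p q : A) x :
  omega_equiv p q -> omega_equiv (trans x p) (trans x q).
Proof.
move=> /asboolP pq; apply/asboolP/funext => u; apply/funext => i.
by rewrite !state_map_trans pq.
Qed.

Lemma repr_omega_equiv A (q : A) :
  omega_equiv (repr (\pi_(min_state A) q)) q.
Proof. by rewrite -[omega_equiv _ _]/(omega_equiv_rel A _ _) -eqmodE reprK. Qed.

Lemma minT_outE A x (q : A) : @out n (minT A) x (\pi_(min_state A) q) = out x q.
Proof. exact: omega_equiv_out (repr_omega_equiv q). Qed.

Lemma minT_transE A x (q : A) :
  @trans n (minT A) x (\pi_(min_state A) q) = \pi_(min_state A) (trans x q).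
Proof. apply/eqmodP; exact: omega_equiv_trans (repr_omega_equiv q). Qed.

Definition synchronizing A k (s : k.-tuple 'I_n -> A) :=
  forall (w : k.-tuple 'I_n) (q : A), wtrans w q = s w.

Definition strongly_synchronizing A :=
  exists k (s : k.-tuple 'I_n -> A), synchronizing s.

(* The image of s; it does not depend on the level k (see in_coreE). The
   predicate is empty when A is not strongly synchronizing. *)
Definition in_core A : pred A := fun q =>
  `[< exists k (s : k.-tuple 'I_n -> A),
        synchronizing s /\ exists w, q = s w >].

Lemma in_core_trans A x (q : A) : in_core q -> in_core (trans x q).
Proof.
move=> /asboolP[k [s [sP [w ->]]]]; apply/asboolP; exists k, s; split=> //.
exists [tuple of behead (rcons w x)].
have [y <-] : exists y : A, wtrans (behead (rcons w x)) y = trans x (s w).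
  rewrite -(sP w (s w)) -wtrans_rcons; move: (s w) => p.
  by case: (tval w) => [|a v] /=; [exists (trans x p) | exists (trans a p)].
exact: (sP [tuple of behead (rcons w x)] y).
Qed.

Lemma in_coreE A k (s : k.-tuple 'I_n -> A) q :
  (0 < n)%N -> synchronizing s -> in_core q <-> exists w, q = s w.
Proof.
move=> n0 sP; split=> [/asboolP[k' [s' [s'P [w' qE]]]]|[w qE]]; last first.
  by apply/asboolP; exists k, s; split=> //; exists w.
pose v := nseq k (Ordinal n0) ++ w'.
have wk : size (drop k' v) == k.
  by rewrite size_drop size_cat size_nseq size_tuple addnK.
exists (Tuple wk); rewrite -(sP _ (wtrans (take k' v) q)) /= /wtrans.
rewrite -foldl_cat cat_take_drop foldl_cat.
by rewrite -/(wtrans w' _) (s'P w') qE.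
Qed.

Definition Core A : transducer n := @Transducer n {q : A | in_core q}
  (fun x q => Sub (trans x (val q)) (in_core_trans x (valP q)))
  (fun x q => out x (val q)).

Definition is_core A := forall q : A, in_core q.

Definition tprod A B : transducer n := @Transducer n (A * B)%type
  (fun x pq => (trans x pq.1, trans (out x pq.1) pq.2))
  (fun x pq => out (out x pq.1) pq.2).

Definition tid : transducer n :=
  @Transducer n unit (fun _ q => q) (fun x _ => x).

(* [A * (A * ...)] with m factors; [tid] only serves as the value at m = 0. *)
Definition tpow A m : transducer n := iterop m tprod A tid.

(* Minimal representatives of the elements of the monoid P~_n. *)
Definition Ptilde A := [/\ minimal A, strongly_synchronizing A & is_core A].

Definition shift_map A k (s : k.-tuple 'I_n -> A)
    (x : {ptws int -> discrete_topology 'I_n}) :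
    {ptws int -> discrete_topology 'I_n} :=
  fun i => out (x i) (s [tuple x (i - k%:Z + j%:Z)%R | j < k]).

Lemma shift_map_level A k k' (s : k.-tuple 'I_n -> A)
    (s' : k'.-tuple 'I_n -> A) :
  synchronizing s -> synchronizing s' -> shift_map s = shift_map s'.
Proof.
move=> sP s'P; apply/funext => x; apply/funext => i; congr out.
pose W m := [seq x (i - m%:Z + j%:Z)%R | j <- iota 0 m].
have WE m : tval [tuple x (i - m%:Z + j%:Z)%R | j < m] = W m.
  by rewrite /= /W -val_enum_ord -map_comp.
have dropW m d : drop d (W (d + m)) = W m.
  rewrite /W -map_drop drop_iota addKn add0n -[in LHS](addn0 d) iotaDl.
  rewrite -map_comp.
  apply: eq_map => j /=; rewrite addn0 !PoszD opprD.
  by rewrite -[in LHS]addrA (addrACA (- d%:Z)%R) addNr add0r addrA.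
have H l (t : l.-tuple 'I_n -> A) d q : synchronizing t ->
    t [tuple x (i - l%:Z + j%:Z)%R | j < l] = wtrans (W (d + l)) q.
  move=> tP; rewrite -(tP _ (wtrans (take d (W (d + l))) q)) WE -(dropW l d).
  by rewrite /wtrans -foldl_cat cat_take_drop.
pose q := s [tuple x (i - k%:Z + j%:Z)%R | j < k].
by rewrite (H _ s k' q sP) (H _ s' k q s'P) addnC.
Qed.

Definition homeomorphism (T U : topologicalType) (f : T -> U) :=
  exists g : U -> T, [/\ cancel f g, cancel g f, continuous f & continuous g].

(* The choice of the level is irrelevant by shift_map_level. *)
Definition Pn A := Ptilde A /\
  exists k (s : k.-tuple 'I_n -> A),
    synchronizing s /\ homeomorphism (shift_map s).

Definition has_inverse A := forall q : A, bijective (fun x => out x q).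

Definition Hn A := Pn A /\ has_inverse A.

Definition core_exponential_growth (R : realType) A :=
  exists c : R, (0 < c)%R /\
  exists M : nat, forall m : nat, (M <= m)%N ->
    (expR (c * m%:R) <= #|minT (Core (tpow A m))|%:R)%R.

End Transducer.

(* Main.v *)
(* The witness has two states, recording whether the last letter read was 0; one
   state acts on letters by the 3-cycle (0 1 2), the other by the swap (0 1).
   A state of its m-th power is a word of length m over the two states, and any
   two distinct words are inequivalent, because the first coordinate at which
   they differ can be pushed to the last coordinate, where it becomes visible.
   A word in which the state "last letter was 0" occurs only at positions of one
   parity is the successor of such a word for the other parity (its predecessor
   is p_t = w_(t-1) xor w_(t+1), as in Wolfram's rule 90). Iterating backwards
   puts all these words in the core, which thus has at least 2^(m/2) states. *)
Require Import Defs.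
From mathcomp Require Import all_boot reals.
From mathcomp Require Import all_order all_algebra perm.
From mathcomp Require Import boolp classical_sets topology sequences exp.

Set Implicit Arguments.
Unset Strict Implicit.
Unset Printing Implicit Defensive.

Import Order.TTheory GRing.Theory Num.Theory.

Local Open Scope quotient_scope.

(** * Products, cores and shift maps of general transducers *)

Section Transducers.
Variable n : nat.
Implicit Types A B : transducer n.

Lemma wtrans_cat A v w (q : A) : wtrans (v ++ w) q = wtrans w (wtrans v q).
Proof. exact: foldl_cat. Qed.

Lemma size_wout A w (q : A) : size (wout w q) = size w.
Proof. by elim: w q => //= x w IHw q; rewrite IHw. Qed.

Lemma omega_equivP A (p q : A) :
  omega_equiv p q <-> forall w, wout w p = wout w q.
Proof.
split=> [/asboolP pq w|pq].
  case: w => [//|x w]; rewrite -(mkseq_nth x (x :: w)).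
  by rewrite -!mkseq_state_map pq.
apply/asboolP/funext => x; apply/funext => i.
have := pq (mkseq x i.+1).
by rewrite -!mkseq_state_map !mkseqS => /rcons_inj[].
Qed.

Lemma wout_surj A (q : A) w : has_inverse A -> exists v, wout v q = w.
Proof.
move=> Ainv; elim: w q => [|y w IHw] q; first by exists [::].
have [f _ fK] := Ainv q; have [v vE] := IHw (trans (f y) q).
by exists (f y :: v); rewrite /= fK vE.
Qed.

Lemma wtrans_tprod A B w (p : A) (q : B) :
  wtrans w ((p, q) : tprod A B) = (wtrans w p, wtrans (wout w p) q).
Proof. by elim: w p q => //= x w IHw p q; rewrite -IHw. Qed.

Lemma wout_tprod A B w (p : A) (q : B) :
  wout w ((p, q) : tprod A B) = wout (wout w p) q.
Proof. by elim: w p q => //= x w IHw p q; rewrite IHw. Qed.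

(** An invertible first factor can output any word, so the second factor gets tested on all
    words. *)
Lemma omega_equiv_tprodl A B (p : A) (q q' : B) : has_inverse A ->
  omega_equiv ((p, q) : tprod A B) ((p, q') : tprod A B) -> omega_equiv q q'.
Proof.
move=> Ainv /omega_equivP qq'; apply/omega_equivP => w.
have [v <-] := wout_surj p w Ainv.
by rewrite -!wout_tprod.
Qed.

Definition reset A k := forall w (p q : A),
  size w = k -> wtrans w p = wtrans w q.

(** The first [k] letters merge the first components, so the remaining [l] letters reach both second
    components as the same word. *)
Lemma reset_tprod A B k l :
  reset A k -> reset B l -> reset (tprod A B) (k + l).
Proof.
move=> Ak Bl w [p q] [p' q'] wE.
have vE : size (take k w) = k by rewrite size_takel // wE leq_addr.
rewrite -(cat_take_drop k w) !wtrans_cat !wtrans_tprod (Ak _ p p') //.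
congr pair; apply: Bl.
by rewrite size_wout size_drop wE addKn.
Qed.

Lemma reset_in_core A k w (p : A) :
  reset A k -> size w = k -> in_core (wtrans w p).
Proof.
move=> Ak wk; apply/asboolP.
exists k, (fun v : k.-tuple _ => wtrans v p); split.
  by move=> v q; apply: Ak; rewrite size_tuple.
by move/eqP: wk => wk; exists (Tuple wk).
Qed.

Lemma minimal_Core A : minimal A -> minimal (Core A).
Proof.
have valE w (q : Core A) : wout w q = wout w (val q).
  by elim: w q => //= x w IHw q; rewrite IHw.
move=> Amin p q /omega_equivP pq; apply/val_inj/Amin/omega_equivP => w.
by rewrite -!valE.
Qed.

Lemma leq_card_minT A : minimal A -> #|A| <= #|minT A|.
Proof.
move=> Amin; apply: (leq_card (fun q : A => (\pi_(min_state A) q : minT A))).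
move=> p q /eqmodP; exact: Amin.
Qed.

(** The value at [i] depends only on the coordinates from [i - k] to [i], each locally constant in
    the product topology. *)
Lemma shift_map_continuous A k (s : k.-tuple 'I_n -> A) :
  continuous (shift_map s).
Proof.
move=> x; apply/cvg_sup; first exact: (fmap_filter _ (nbhs_filter x)).
move=> i U [V] [[W _ <-] /= Wx WU].
have near_eq j : \forall y \near x, y j = x j.
  have := @proj_continuous _ (fun=> discrete_topology 'I_n) j x [set x j]%classic.
  by apply; rewrite nbhs_principalE; apply/principal_filterP.
have near_window : \forall y \near x,
    forall j : 'I_k, y (i - k%:Z + j%:Z)%R = x (i - k%:Z + j%:Z)%R.
  by apply: (@filter_forall _ _ _ _ (nbhs_filter x)) => j; exact: near_eq.
apply: (@filterS2 _ _ (nbhs_filter x) _ _ _ _ (near_eq i) near_window) => y yi yj.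
apply: WU => /=; move: Wx; rewrite /shift_map yi.
suff -> : [tuple y (i - k%:Z + j%:Z)%R | j < k] =
  [tuple x (i - k%:Z + j%:Z)%R | j < k] by [].
by apply: eq_from_tnth => j; rewrite !tnth_mktuple.
Qed.

End Transducers.

(** * The witness and its membership in [Hn] *)

Section SwapTransducer.
Variable n : nat.
Local Notation letter := 'I_n.+3.
Let o0 : letter := Ordinal (isT : 0 < n.+3).
Let o1 : letter := Ordinal (isT : 1 < n.+3).
Let o2 : letter := Ordinal (isT : 2 < n.+3).

(* The state [true] records that the letter just read is 0. *)
Definition swapT : transducer n.+3 := @Transducer n.+3 bool
  (fun x _ => x == o0)
  (fun x q => tperm o0 o1 (if q then tperm o1 o2 x else x)).

(* Both output permutations of [swapT] send exactly the letter 0 to 1, so this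
   inverse can recover the state of [swapT] from the letter it last read. *)
Definition swapT_inv : transducer n.+3 := @Transducer n.+3 bool
  (fun y _ => y == o1)
  (fun y q => if q then tperm o1 o2 (tperm o0 o1 y) else tperm o0 o1 y).

Lemma swapT_out0 (q : swapT) : out o0 q = o1.
Proof. by rewrite /=; case: q; rewrite ?(@tpermD _ o1) // tpermL. Qed.

Lemma swapT_out1 (q : swapT) : out o1 q = if q then o2 else o0.
Proof. by rewrite /=; case: q; [rewrite tpermL tpermD | rewrite tpermR]. Qed.

Lemma swapT_out2 (q : swapT) : out o2 q = if q then o0 else o2.
Proof. by rewrite /=; case: q; [rewrite !tpermR | rewrite tpermD]. Qed.

Lemma swapT_outK (q : bool) :
  cancel (fun x => @out _ swapT x q) (fun y => @out _ swapT_inv y q).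
Proof. by move=> x; rewrite /=; case: q; rewrite !tpermK. Qed.

Lemma swapT_inv_outK (q : bool) :
  cancel (fun y => @out _ swapT_inv y q) (fun x => @out _ swapT x q).
Proof. by move=> x; rewrite /=; case: q; rewrite !tpermK. Qed.

Lemma swapT_out_eq1 (q : swapT) x : (out x q == o1) = (x == o0).
Proof.
rewrite /= (can2_eq (tpermK _ _) (tpermK _ _)) tpermR.
by case: q; rewrite // (can2_eq (tpermK _ _) (tpermK _ _)) tpermD.
Qed.

Lemma swapT_inv_out_eq0 (q : swapT_inv) y : (out y q == o0) = (y == o1).
Proof. by rewrite -(swapT_out_eq1 q) swapT_inv_outK. Qed.

Lemma swapT_has_inverse : has_inverse swapT.
Proof.
by move=> q; exists (fun y => @out _ swapT_inv y q);
  [exact: swapT_outK | exact: swapT_inv_outK].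
Qed.

Let sync1 (w : 1.-tuple letter) : swapT := thead w == o0.
Let sync1_inv (w : 1.-tuple letter) : swapT_inv := thead w == o1.

Lemma synchronizing_swapT : synchronizing sync1.
Proof. by case/tupleP=> x w q; rewrite /sync1 theadE (tuple0 w). Qed.

Lemma shift_map_homeo : homeomorphism (shift_map sync1).
Proof.
have fE x i : shift_map sync1 x i = @out _ swapT (x i) (x (i - 1)%R == o0).
  by rewrite /shift_map /sync1 /thead tnth_mktuple addr0.
have gE y i :
    shift_map sync1_inv y i = @out _ swapT_inv (y i) (y (i - 1)%R == o1).
  by rewrite /shift_map /sync1_inv /thead tnth_mktuple addr0.
exists (shift_map sync1_inv); split.
- move=> x; apply/funext => i; rewrite gE !fE swapT_out_eq1; exact: swapT_outK.
- move=> y; apply/funext => i; rewrite fE !gE swapT_inv_out_eq0.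
  exact: swapT_inv_outK.
- exact: shift_map_continuous.
- exact: shift_map_continuous.
Qed.

Lemma minimal_swapT : minimal swapT.
Proof.
move=> p q /(@omega_equiv_out _ swapT p q o1).
by rewrite !swapT_out1; case: p; case: q.
Qed.

Lemma Hn_swapT : Hn swapT.
Proof.
split; last exact: swapT_has_inverse.
split; last first.
  exists 1, sync1; split; [exact: synchronizing_swapT|exact: shift_map_homeo].
split; first exact: minimal_swapT.
  by exists 1, sync1; exact: synchronizing_swapT.
move=> q; apply/asboolP; exists 1, sync1.
split; first exact: synchronizing_swapT.
by exists [tuple if q then o0 else o1]; case: q.
Qed.

(** * Synchronization and minimality of the powers *)

Lemma reset_tpow_swapT m : reset (tpow swapT m.+1) m.+1.
Proof.
have swapT1 : reset swapT 1 by move=> [|x [|//]].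
by elim: m => // m IHm; exact: (reset_tprod swapT1 IHm).
Qed.

(* If the coordinates of two states first differ at position t, then reading
   the letter 1 moves the first difference to position t + 1: the columns
   agree up to t, where the outputs become 2 and 0. *)
Lemma minimal_tpow_swapT m : minimal (tpow swapT m.+1).
Proof.
elim: m => [|m IHm]; first exact: minimal_swapT.
(* The first component of a successor records whether the letter read was 0. *)
have tpow_trans_neq (P Q : tpow swapT m.+1) : trans o0 P <> trans o2 Q.
  by case: {IHm} m P Q => //= m P Q [].
move=> [p P] [q Q] pq; have [pE|pNq] := eqVneq p q.
  by move: pq; rewrite pE => /(omega_equiv_tprodl swapT_has_inverse)/IHm ->.
have := @omega_equiv_trans _ (tpow swapT m.+2) _ _ o1 pq.
move=> /(omega_equiv_tprodl swapT_has_inverse)/IHm.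
rewrite !swapT_out1; case: p q pNq {pq} => [] [] // _.
  by move/esym/tpow_trans_neq.
by move/tpow_trans_neq.
Qed.

(** * Core states of the powers, found through predecessors *)

Fixpoint tpow_state m (u : nat -> bool) : tpow swapT m.+1 :=
  if m is m'.+1 then (u 0, tpow_state m' (fun t => u t.+1)) else u 0.

(** Entry [t] is the letter that enters factor [t] when the power reads [x]. *)
Fixpoint column (x : letter) (u : nat -> bool) t : letter :=
  if t is t'.+1 then @out _ swapT (column x u t') (u t') else x.

Lemma columnS x u t :
  column x u t.+1 = column (@out _ swapT x (u 0)) (fun t => u t.+1) t.
Proof. by elim: t => //= t <-. Qed.

Lemma trans_tpow_state m x u :
  trans x (tpow_state m u) = tpow_state m (fun t => column x u t == o0).
Proof.
elim: m x u => //= m IHm x u; rewrite IHm; congr (_, tpow_state _ _).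
by apply/funext => t; rewrite -columnS.
Qed.

Lemma tpow_state_inj m u v : tpow_state m u = tpow_state m v ->
  forall t, t <= m -> u t = v t.
Proof.
elim: m u v => [|m IHm] u v /=; first by move=> uv [].
by move=> [u0 uv] [//|t]; exact: (IHm _ _ uv).
Qed.

Definition supported (e : bool) (u : nat -> bool) :=
  forall t, odd t = e -> u t = false.

(* A zero of the column at time t is produced from a 1 or a 2 at time t - 1,
   and is followed by a 1; the state needed at a time t with a nonzero entry
   therefore only depends on whether the entries at t - 1 and t + 1 are 0. *)
Lemma supported_pred e u : supported e u -> exists x v,
  supported (~~ e) v /\ forall t, (column x v t == o0) = u t.
Proof.
move=> ue.
pose prev t := if t is t'.+1 then u t' else false.
pose c t := if u t then o0 else if prev t then o1 else o2.
(* Adjacent times have opposite parities. *)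
have uS t : u t -> u t.+1 = false.
  move=> ut; apply: (ue) => /=; have := ue t; rewrite ut.
  by case: (odd t); case: (e) => // /(_ erefl).
pose v t := prev t (+) u t.+1.
exists (c 0), v; split.
  move=> t te; rewrite /v (@ue t.+1) /= ?te ?negbK // addbF.
  by case: t te => //= t /negb_inj; exact: ue.
suff cE t : column (c 0) v t = c t.
  by move=> t; rewrite cE /c; case: (u t) => //; case: (prev t).
elim: t => // t IHt.
rewrite -[LHS]/(@out _ swapT (column (c 0) v t) (v t)) IHt.
rewrite -[RHS]/(if u t.+1 then o0 else if u t then o1 else o2) /c /v.
have [ut|_] := boolP (u t); first by rewrite swapT_out0 uS.
by case: (prev t); case: (u t.+1); rewrite ?swapT_out1 ?swapT_out2.
Qed.

Lemma supported_in_core m e u : supported e u -> in_core (tpow_state m u).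
Proof.
move=> ue.
suff [w [v [wm <-]]] : exists w v, size w = m.+1 /\
    wtrans w (tpow_state m v) = tpow_state m u.
  by apply: reset_in_core wm; exact: reset_tpow_swapT.
(* Only the number of backward steps is generalized, not the power; the parity [e] flips at each
   step. *)
elim: {1}m.+1 e u ue => [|k IHk] e u ue; first by exists [::], u.
have [x [v [vNe vu]]] := supported_pred ue.
have [w [v' [wk wE]]] := IHk _ _ vNe.
exists (rcons w x), v'; split; first by rewrite size_rcons wk.
rewrite wtrans_rcons wE trans_tpow_state; congr tpow_state.
exact/funext.
Qed.

(** * The exponential lower bound *)

Lemma card_Core_tpow_swapT m :
  2 ^ m.+1./2 <= #|minT (Core (tpow swapT m.+1))|.
Proof.
apply: leq_trans (leq_card_minT (minimal_Core (@minimal_tpow_swapT m))).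
(* The free bits sit at the [m.+1./2] odd times up to [m]; the [oapp] default only concerns later
   times. *)
pose u (f : {ffun 'I_m.+1./2 -> bool}) t :=
  if odd t then oapp f false (insub t./2) else false.
have uP f : supported false (u f) by move=> t te; rewrite /u te.
pose F f : Core (tpow swapT m.+1) := Sub (tpow_state m (u f))
  (supported_in_core m (uP f)).
have F_inj : injective F.
  move=> f g /(congr1 val)/tpow_state_inj fg; apply/ffunP => i.
  have im : i.*2.+1 <= m.
    by rewrite -ltnS -[_ < _]/(i.+1.*2 <= m.+1) -geq_half_double.
  have := fg _ im.
  by rewrite /u /= odd_double uphalf_double !valK.
by have := leq_card F F_inj; rewrite card_ffun card_bool card_ord.
Qed.

Lemma growth_swapT (R : realType) : core_exponential_growth R swapT.
Proof.
(* If h is half the exponent M, rounded down, then M <= 2h + 1 <= 4h once M >= 2. *)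
exists (ln 2 / 4)%R; split; first by rewrite divr_gt0 ?ln_gt0 ?ltr1n.
exists 2 => -[//|m] m2.
apply: (@le_trans _ _ (2 ^ m.+1./2)%:R)%R; last first.
  by rewrite ler_nat card_Core_tpow_swapT.
rewrite natrX -[X in (_ <= X ^+ _)%R]lnK ?posrE // -expRM_natr ler_expR.
rewrite -mulrA ler_wpM2l ?ln_ge0 ?ler1n // ler_pdivrMl // -natrM ler_nat.
apply: (@leq_trans m.+1./2.*2.+1).
  by rewrite -[X in X <= _]odd_double_half -[_.*2.+1]add1n leq_add2r leq_b1.
by rewrite -(mulnA 2 2) !mul2n -[leqRHS]addnn -addn1 leq_add2l double_gt0 half_gt0.
Qed.

End SwapTransducer.

Theorem theorem3p5 (R : realType) (n : nat) (hn : (2 < n)%N) :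
  exists A : transducer n, Hn A /\ core_exponential_growth R A.
Proof.
case: n hn => [|[|[|n]]] // _; exists (swapT n).
by split; [exact: Hn_swapT | exact: growth_swapT].
Qed.
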